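(* Let $X$ and $Y$ be two $(\varepsilon,r_0)$-Reifenberg-flat domains in $\mathbb{R}^N$ satisfying $d_H(\partial X,\partial Y)\le 2r_0$. Then $$d_H(\partial X,\partial Y)\le\frac{4}{1-2\varepsilon}\min\big\{d_H(X,Y),\,d_H(X^c,Y^c)\big\}.$$
   Context: Notation: $A^c=\mathbb{R}^N\setminus A$; $B(x,r)$ is the open ball; $d(x,A)$ is the distance from a point to a set; the Hausdorff distance is $d_H(X,Y)=\max\{\sup_{x\in X}d(x,Y),\ \sup_{y\in Y}d(y,X)\}$ (with values in $[0,+\infty]$; conventions $d(x,\emptyset)=+\infty$ and supremum over the empty set equal to $0$). Reifenberg-flat domain: let $0<\varepsilon<1/2$ and $r_0>0$. An $(\varepsilon,r_0)$-Reifenberg-flat domain $\Omega\subseteq\mathbb{R}^N$ is a nonempty open set such that: (i) for every $x\in\partial\Omega$ and every $0<r\le r_0$ there is a (affine) hyperplane $P(x,r)$ containing $x$ with $\frac1r d_H\big(\partial\Omega\cap B(x,r),P(x,r)\cap B(x,r)\big)\le\varepsilon$; (ii) for every $x\in\partial\Omega$, one of the two connected components of $B(x,r_0)\cap\{y: d(y,P(x,r_0))\ge 2\varepsilon r_0\}$ is contained in $\Omega$ and the other one is contained in $\mathbb{R}^N\setminus\Omega$. *)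

(* Defs.v *)
From mathcomp Require Import all_boot all_order all_algebra.
From mathcomp Require Import boolp classical_sets reals ereal topology normedtype.

Set Implicit Arguments.
Unset Strict Implicit.
Unset Printing Implicit Defensive.

Import Order.TTheory GRing.Theory Num.Theory.
Import numFieldNormedType.Exports.

Local Open Scope classical_set_scope.
Local Open Scope ring_scope.

(* The space R^N is ['rV[R]_N].  The library norm on row vectors is the sup
   norm, so all metric notions below are built from the Euclidean norm; the
   two norms induce the same topology, so [open], [closure], [interior] and
   [connected_component] are the library ones. *)

Definition dotv (R : realType) (N : nat) (u v : 'rV[R]_N) : R :=
  \sum_(i < N) u ord0 i * v ord0 i.

Definition enorm (R : realType) (N : nat) (u : 'rV[R]_N) : R :=
  Num.sqrt (dotv u u).

Definition eball (R : realType) (N : nat) (x : 'rV[R]_N) (r : R) :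
    set 'rV[R]_N :=
  [set y | enorm (y - x) < r].

(* Equal to [+oo] when [A] is empty. *)
Definition dist_set (R : realType) (N : nat) (x : 'rV[R]_N)
    (A : set 'rV[R]_N) : \bar R :=
  ereal_inf [set (enorm (x - a))%:E | a in A].

(* [ereal_sup set0 = -oo]; as distances are nonnegative, taking the maximum
   with [0] only affects the case of an empty [X]. *)
Definition excess (R : realType) (N : nat) (X Y : set 'rV[R]_N) : \bar R :=
  maxe 0%E (ereal_sup [set dist_set x Y | x in X]).

Definition hausdorff_dist (R : realType) (N : nat) (X Y : set 'rV[R]_N) :
    \bar R :=
  maxe (excess X Y) (excess Y X).

Definition bdry (T : topologicalType) (A : set T) : set T :=
  closure A `\` interior A.

Definition hyperplane (R : realType) (N : nat) (P : set 'rV[R]_N) : Prop :=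
  exists (n : 'rV[R]_N) (c : R), n != 0 /\ P = [set y | dotv n y = c].

Definition components (T : topologicalType) (A : set T) : set (set T) :=
  [set connected_component A x | x in A].

(* [P x r] is the hyperplane chosen at the boundary point [x] and scale [r];
   the same choice is used at scale [r0] in the separation condition. *)
Definition reifenberg_flat (R : realType) (N : nat) (eps r0 : R)
    (Omega : set 'rV[R]_N) : Prop :=
  [/\ Omega !=set0, open Omega &
    exists P : 'rV[R]_N -> R -> set 'rV[R]_N,
      (forall (x : 'rV[R]_N) (r : R), bdry Omega x -> 0 < r -> r <= r0 ->
         [/\ hyperplane (P x r), P x r x &
             ((r^-1)%:E * hausdorff_dist (bdry Omega `&` eball x r)
                                         (P x r `&` eball x r)
              <= eps%:E)%E]) /\
      (forall x : 'rV[R]_N, bdry Omega x ->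
         exists C1 C2 : set 'rV[R]_N,
           [/\ C1 <> C2,
               components (eball x r0 `&`
                 [set y | ((2 * eps * r0)%:E <= dist_set y (P x r0))%E])
               = [set C1; C2],
               C1 `<=` Omega & C2 `<=` ~` Omega])].

(* Main.v *)
(** Near a boundary point x of a flat domain, the two sides of the hyperplane
    P(x,r) at distance more than eps r from it lie one inside and one outside
    the domain, at every scale r <= r0: at r0 this is the separation condition,
    and it passes from r to any r' in [3r/4, r] because the normals u, u' of the
    two hyperplanes, oriented so that u.u' >= 0, have common points x + t(u + u')
    on their positive sides and x - t(u + u') on their negative sides.
    If the ball B(x, delta) around a point x of the boundary of X misses the
    boundary of Y, it lies in Y or in its complement; separation for X at scale
    delta/2 gives two balls of radius delta (1 - 2 eps)/4 inside B(x, delta),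
    one in X and one in its complement, whose centres bound both Hausdorff
    distances from below. *)
Require Import Defs.
From mathcomp Require Import all_boot all_order all_algebra.
From mathcomp Require Import boolp classical_sets reals ereal topology normedtype.
From mathcomp Require Import sequences ring lra.

Import Order.TTheory GRing.Theory Num.Theory.
Import numFieldNormedType.Exports.
Local Open Scope classical_set_scope.
Local Open Scope ring_scope.

(** * Euclidean inner product and norm on row vectors *)

Section Euclidean.
Context {R : realType} {N : nat}.
Implicit Types (u v w x y z : 'rV[R]_N) (a r : R).

Lemma dotvC u v : dotv u v = dotv v u.
Proof. by apply: eq_bigr => i _; rewrite mulrC. Qed.

Lemma dotvDr u v w : dotv u (v + w) = dotv u v + dotv u w.
Proof. by rewrite -big_split; apply: eq_bigr => i _; rewrite !mxE mulrDr. Qed.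

Lemma dotvZr a u v : dotv u (a *: v) = a * dotv u v.
Proof. by rewrite mulr_sumr; apply: eq_bigr => i _; rewrite !mxE; ring. Qed.

Lemma dotvNr u v : dotv u (- v) = - dotv u v.
Proof. by rewrite -scaleN1r dotvZr mulN1r. Qed.

Lemma dotvDl u v w : dotv (v + w) u = dotv v u + dotv w u.
Proof. by rewrite dotvC dotvDr !(dotvC u). Qed.

Lemma dotvZl a u v : dotv (a *: v) u = a * dotv v u.
Proof. by rewrite dotvC dotvZr (dotvC u). Qed.

Lemma dotvNl u v : dotv (- v) u = - dotv v u.
Proof. by rewrite dotvC dotvNr (dotvC u). Qed.

Definition dotvE := (dotvDr, dotvDl, dotvNr, dotvNl, dotvZr, dotvZl).

Lemma dotv_ge0 u : 0 <= dotv u u.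
Proof. by apply: sumr_ge0 => i _; rewrite -expr2 sqr_ge0. Qed.

Lemma dotv_gt0 u : u != 0 -> 0 < dotv u u.
Proof.
move=> u0; rewrite lt_neqAle dotv_ge0 andbT eq_sym; apply: contra u0 => /eqP u0.
apply/eqP/rowP => i; rewrite !mxE; apply/eqP; rewrite -sqrf_eq0 expr2.
rewrite (psumr_eq0P _ u0) // => j _.
by rewrite -expr2 sqr_ge0.
Qed.

Lemma enorm_ge0 u : 0 <= enorm u.
Proof. exact: sqrtr_ge0. Qed.

Lemma enorm_sqr u : enorm u ^+ 2 = dotv u u.
Proof. by rewrite sqr_sqrtr ?dotv_ge0. Qed.

Lemma enorm0 : enorm (0 : 'rV[R]_N) = 0.
Proof. by rewrite /enorm -(scale0r 0) dotvZr mul0r sqrtr0. Qed.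

Lemma enormZ a u : enorm (a *: u) = `|a| * enorm u.
Proof. by rewrite /enorm !dotvE mulrA -expr2 sqrtrM ?sqr_ge0 // sqrtr_sqr. Qed.

Lemma enormN u : enorm (- u) = enorm u.
Proof. by rewrite -scaleN1r enormZ normrN normr1 mul1r. Qed.

Lemma enormB u v : enorm (u - v) = enorm (v - u).
Proof. by rewrite -enormN opprB. Qed.

(** Cauchy-Schwarz for a unit vector: the component of [v] orthogonal to [u] has square norm |v|^2 -
    (u.v)^2 >= 0. *)
Lemma normr_dotv_unit u v : dotv u u = 1 -> `|dotv u v| <= enorm v.
Proof.
move=> u1; rewrite -ler_sqr ?nnegrE ?enorm_ge0 // enorm_sqr real_normK ?num_real //.
have := dotv_ge0 (v - dotv u v *: u).
by rewrite !dotvE u1 (dotvC v u); nra.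
Qed.

Lemma ler_enormD u v : enorm (u + v) <= enorm u + enorm v.
Proof.
have [->|v0] := eqVneq v 0; first by rewrite enorm0 !addr0.
have nv : 0 < enorm v by rewrite sqrtr_gt0 dotv_gt0.
have v1 : dotv ((enorm v)^-1 *: v) ((enorm v)^-1 *: v) = 1.
  by rewrite !dotvE -enorm_sqr; field; rewrite gt_eqF.
have := normr_dotv_unit _ u v1; rewrite !dotvE => /ler_normlW.
rewrite mulrC ler_pdivrMr // => uv.
rewrite -ler_sqr ?nnegrE ?addr_ge0 ?enorm_ge0 // enorm_sqr !dotvE (dotvC u v).
by rewrite sqrrD !enorm_sqr; lra.
Qed.

Lemma ler_enorm_sub y z x : enorm (y - x) <= enorm (y - z) + enorm (z - x).
Proof. by rewrite -(subrKA z y) ler_enormD. Qed.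

Lemma enorm_unit_scale a u : dotv u u = 1 -> enorm (a *: u) = `|a|.
Proof. by move=> u1; rewrite enormZ /enorm u1 sqrtr1 mulr1. Qed.

End Euclidean.

(** * Convex sets and connectedness *)

Section Convexity.
Context {R : realType} {N : nat}.
Implicit Types (A B Omega : set 'rV[R]_N) (u x y z : 'rV[R]_N) (k r : R).

Definition convexs A := forall y z (t : R),
  A y -> A z -> 0 <= t <= 1 -> A (y + t *: (z - y)).

Lemma convexsI A B : convexs A -> convexs B -> convexs (A `&` B).
Proof. by move=> cA cB y z t [Ay By] [Az Bz] t01; split; [apply: cA|apply: cB]. Qed.

Lemma convexs_eball x r : convexs (eball x r).
Proof.
move=> y z t; rewrite /eball /= => yx zx /andP[t0 t1].
have -> : y + t *: (z - y) - x = (1 - t) *: (y - x) + t *: (z - x).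
  by apply/rowP => i; rewrite !mxE; ring.
apply: le_lt_trans (ler_enormD _ _) _.
(* Splitting at 1/2 decides which of the weights 1 - t and t is positive, which keeps the inequality
   strict. *)
by rewrite !enormZ !ger0_norm ?subr_ge0 //; have [?|?] := lerP t 2^-1; nra.
Qed.

Lemma convexs_halfspace_lt u x k : convexs [set y | k < dotv u (y - x)].
Proof.
move=> y z t /=; rewrite !dotvE => ? ? /andP[? ?].
by have [?|?] := lerP t 2^-1; nra.
Qed.

Lemma convexs_halfspace_le u x k : convexs [set y | k <= dotv u (y - x)].
Proof. by move=> y z t /=; rewrite !dotvE => ? ? /andP[? ?]; nra. Qed.

Lemma connected_segment y z :
  connected [set y + t *: (z - y) | t in `[(0 : R), 1]].
Proof.
apply: connected_continuous_connected; first exact: segment_connected.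
apply: continuous_subspaceT => t.
by apply: cvgD; [exact: cvg_cst|apply: cvgZr_tmp; exact: cvg_id].
Qed.

(** A nonempty relatively clopen part [B] of [A] has a nonempty clopen trace on the segment from a
    point of [B] to any point of [A]; the segment being connected, its other end is in [B] too. *)
Lemma convexs_connected A : convexs A -> connected A.
Proof.
move=> cA B [b Bb] [C oC BC] [D cD BD].
have Ab : A b by move: Bb; rewrite BC => -[].
apply/seteqP; split => [a|a Aa]; first by rewrite BC => -[].
set L := [set b + t *: (a - b) | t in `[(0 : R), 1]].
have LA : L `<=` A.
  by move=> _ [t t01 <-]; apply: cA; rewrite //= -in_itv.
have Lb : L b by exists 0; rewrite ?scale0r ?addr0 //= in_itv /= lexx ler01.
have La : L a.
  by exists 1; rewrite ?scale1r ?subrKC //= in_itv /= lexx ler01.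
have restr E : B = A `&` E -> L `&` B = L `&` E.
  by move=> ->; rewrite setIA (setIidl LA).
have LB : L `&` B = L.
  apply: connected_segment; first by exists b.
  - by exists C => //; exact: restr.
  - by exists D => //; exact: restr.
by move: La; rewrite -LB => -[].
Qed.

End Convexity.

(** Off the boundary of [W], the closure of [W] is [W] itself, so the trace of [W] on [A] is both
    relatively open and relatively closed. *)
Lemma connected_disjoint_bdry (T : topologicalType) (A W : set T) :
  open W -> connected A -> (forall y, A y -> ~ bdry W y) ->
  forall y z, A y -> W y -> A z -> W z.
Proof.
move=> oW cA AW y z Ay Wy Az.
have : A `&` W = A.
  apply: cA; first by exists y.
  - by exists W.
  - exists (closure W); first exact: closed_closure.
    apply/seteqP; split => p [Ap Wp]; split => //; first exact: subset_closure.
    apply: contrapT => nWp; apply: (AW p Ap); split => //.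
    by move/interior_subset.
by move=> E; rewrite -E in Az; case: Az.
Qed.

(** * Bounds on distances to sets and on the Hausdorff distance *)

Section Separation.
Context {R : realType} {N : nat}.
Implicit Types (A B Omega P : set 'rV[R]_N) (u x y z : 'rV[R]_N).
Implicit Types (k r eps : R).

Lemma dist_set_ge k z A :
  (forall a, A a -> k <= enorm (z - a)) -> (k%:E <= dist_set z A)%E.
Proof. by move=> h; apply: le_ereal_inf_tmp => _ [a Aa <-]; rewrite lee_fin h. Qed.

Lemma dist_set_le z A a : A a -> (dist_set z A <= (enorm (z - a))%:E)%E.
Proof. by move=> Aa; apply: ereal_inf_lbound; exists a. Qed.

Lemma dist_set_le_excess z A B : A z -> (dist_set z B <= excess A B)%E.
Proof.
by move=> Az; rewrite le_max; apply/orP; right; apply: ereal_sup_ubound; exists z.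
Qed.

Lemma hausdorff_distC A B : hausdorff_dist A B = hausdorff_dist B A.
Proof. by rewrite /hausdorff_dist maxC. Qed.

Lemma hausdorff_dist_ge0 A B : (0 <= hausdorff_dist A B)%E.
Proof. by rewrite /hausdorff_dist /excess !le_max lexx. Qed.

Lemma hausdorff_dist_le A B (c : \bar R) : (hausdorff_dist A B <= c)%E =
  (excess A B <= c)%E && (excess B A <= c)%E.
Proof. by rewrite /hausdorff_dist ge_max. Qed.

Lemma excess_le_hausdorff_dist A B : (excess A B <= hausdorff_dist A B)%E.
Proof. by have := lexx (hausdorff_dist A B); rewrite hausdorff_dist_le => /andP[]. Qed.

Lemma hausdorff_dist_ge k z A B :
  A z -> (forall y, eball z k y -> ~ B y) -> (k%:E <= hausdorff_dist A B)%E.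
Proof.
move=> Az zB; apply: le_trans (excess_le_hausdorff_dist A B).
apply: le_trans (dist_set_le_excess z A B Az).
apply: dist_set_ge => b Bb; rewrite leNgt enormB; apply/negP => bz.
exact: (zB b).
Qed.

(** * Unit normals, slabs around the boundary and separated sides *)

Lemma hyperplane_unit_normal P x : hyperplane P -> P x ->
  exists2 u, dotv u u = 1 & P = [set y | dotv u (y - x) = 0].
Proof.
move=> [n [c [n0 ->]]] /= nx.
have nn : 0 < enorm n by rewrite sqrtr_gt0 dotv_gt0.
exists ((enorm n)^-1 *: n).
  by rewrite !dotvE -enorm_sqr; field; rewrite gt_eqF.
apply/seteqP; split => y /=; rewrite !dotvE nx -mulrBr.
  by move=> ->; rewrite subrr mulr0.
by move/eqP; rewrite mulf_eq0 invr_eq0 gt_eqF //= subr_eq0 => /eqP.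
Qed.

(** The distance to the hyperplane is |u.(y - x)|: it is attained at the foot of the perpendicular,
    and Cauchy-Schwarz bounds it from below. *)
Lemma dist_set_hyperplane_ge u x y k : dotv u u = 1 ->
  (k%:E <= dist_set y [set p | dotv u (p - x) = 0%R])%E =
  (k <= `|dotv u (y - x)|).
Proof.
move=> u1; apply/idP/idP => [h|h].
  rewrite -lee_fin; apply: le_trans h _.
  apply: le_trans (dist_set_le y _ (y - dotv u (y - x) *: u) _) _.
    by rewrite /= !dotvE u1; ring.
  by rewrite subKr enorm_unit_scale.
apply: dist_set_ge => p /= px; apply: le_trans h _.
have -> : dotv u (y - x) = dotv u (y - p) by move: px; rewrite !dotvE; lra.
exact: normr_dotv_unit.
Qed.

Lemma flat_bdry_slab eps r u x A : dotv u u = 1 -> 0 < r ->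
  ((r^-1)%:E * hausdorff_dist (A `&` eball x r)
     ([set y | dotv u (y - x) = 0%R] `&` eball x r) <= eps%:E)%E ->
  forall y, A y -> eball x r y -> `|dotv u (y - x)| <= eps * r.
Proof.
move=> u1 r0; rewrite lee_pdivrMl // -EFinM mulrC => hd y Ay yx.
rewrite -lee_fin; apply: le_trans hd.
apply: le_trans (excess_le_hausdorff_dist _ _).
apply: le_trans (dist_set_le_excess y _ _ (conj Ay yx)).
(* Enlarging the disc [P] inside the ball to the whole hyperplane can only decrease the distance. *)
apply: le_trans (_ : dist_set y [set p | dotv u (p - x) = 0%R] <= _)%E.
  by rewrite dist_set_hyperplane_ge.
by apply: ereal_inf_le_tmp => _ [a [ha _] <-]; exists a.
Qed.

(* With the paper's notation, [u] is a unit normal of P(x, r), oriented towards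
   [Omega]. *)
Definition separates eps Omega x r u := [/\ dotv u u = 1,
  forall y, eball x r y -> eps * r < dotv u (y - x) -> Omega y &
  forall y, eball x r y -> eps * r < dotv (- u) (y - x) -> ~ Omega y].

(** * Separation at one scale and its transfer to all smaller scales *)

(** Each cap beyond the slab is convex, hence connected, and misses the boundary, so one test point
    per cap decides the whole cap. *)
Lemma separates_of_slab eps Omega x r u (yp ym : 'rV[R]_N) :
  open Omega -> dotv u u = 1 ->
  (forall y, bdry Omega y -> eball x r y -> `|dotv u (y - x)| <= eps * r) ->
  eball x r yp -> eps * r < dotv u (yp - x) -> Omega yp ->
  eball x r ym -> eps * r < dotv (- u) (ym - x) -> ~ Omega ym ->
  separates eps Omega x r u.
Proof.
move=> oO u1 slab bp dp Op bm dm Om.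
pose cap v := eball x r `&` [set y | eps * r < dotv v (y - x)].
have cap_conn v : connected (cap v).
  apply: convexs_connected; apply: convexsI;
    [exact: convexs_eball|exact: convexs_halfspace_lt].
have capP y : cap u y -> ~ bdry Omega y.
  by move=> [yb /= yd] /slab/(_ yb)/ler_normlW; rewrite leNgt yd.
have capM y : cap (- u) y -> ~ bdry Omega y.
  move=> [yb /= yd] /slab/(_ yb); rewrite -normrN -dotvNl => /ler_normlW.
  by rewrite leNgt yd.
split=> // y yb yd.
  by apply: (connected_disjoint_bdry _ _ _ oO (cap_conn u) capP yp).
move=> Oy; apply: Om.
by apply: (connected_disjoint_bdry _ _ _ oO (cap_conn (- u)) capM y).
Qed.

Lemma separates_smaller eps Omega x r r' u u' :
  open Omega -> eps < 1 / 2 -> 0 < eps -> 0 < r' -> r' <= r -> 3 * r <= 4 * r' ->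
  separates eps Omega x r u -> dotv u' u' = 1 ->
  (forall y, bdry Omega y -> eball x r' y -> `|dotv u' (y - x)| <= eps * r') ->
  exists v, separates eps Omega x r' v.
Proof.
move=> oO e1 e0 r'0 r'r rr' [u1 sp sm].
(* The slab is symmetric, so [u'] may be replaced by its opposite. *)
wlog c0 : u' / 0 <= dotv u u' => [hwlog|] u'1 slab.
  have [c0|c0] := lerP 0 (dotv u u'); first exact: (hwlog u').
  apply: (hwlog (- u')); rewrite ?dotvE ?u'1 ?opprK //; first by lra.
  by move=> y hy yb; rewrite dotvNl normrN; apply: slab.
set c := dotv u u' in c0.
(* Both heights of [w] are 2r'/3 >= r/2 > eps r, and |w|^2 = 2(2r'/3)^2/(1+c) < r'^2. *)
pose t := (2 / 3) * r' / (1 + c).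
pose w := t *: (u + u').
have tc : t * (1 + c) = 2 / 3 * r' by rewrite /t; field; lra.
have wu : dotv u w = 2 / 3 * r' by rewrite -tc /w !dotvE u1 -/c; ring.
have wu' : dotv u' w = 2 / 3 * r'.
  by rewrite -tc /w !dotvE u'1 (dotvC u') -/c; ring.
have wn : enorm w < r'.
  rewrite -ltr_sqr ?nnegrE ?enorm_ge0 ?(ltW r'0) // enorm_sqr.
  have t0 : 0 <= t by rewrite /t divr_ge0 //; nra.
  have -> : dotv w w = t * (4 / 3 * r').
    by rewrite {1}/w dotvZl dotvDl wu wu'; ring.
  (* This uses c >= 0, and yields |w|^2 <= 8/9 r'^2. *)
  have : t <= 2 / 3 * r' by nra.
  nra.
clearbody w.
have wb s : s = 1 \/ s = -1 -> eball x r' (x + s *: w).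
  by case=> ->; rewrite /eball /= addrC addKr ?scaleN1r ?scale1r ?enormN.
have wbr s : s = 1 \/ s = -1 -> eball x r (x + s *: w).
  by move=> /wb; rewrite /eball /= => /lt_le_trans; apply.
have [hp hm] : (1 = 1 :> R \/ 1 = -1 :> R) /\ (-1 = 1 :> R \/ -1 = -1 :> R).
  by split; [left|right].
exists u'; apply: (separates_of_slab _ _ _ _ _ (x + 1 *: w) (x + (-1) *: w)) => //.
- exact: wb.
- by rewrite addrC addKr dotvZr wu'; nra.
- by apply: sp; [exact: wbr|rewrite addrC addKr dotvZr wu; nra].
- exact: wb.
- by rewrite addrC addKr !dotvE wu'; nra.
- by apply: sm; [exact: wbr|rewrite addrC addKr !dotvE wu; nra].
Qed.

(** The set is the union of two connected caps; as it has two distinct components, the caps lie in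
    different ones, and the component inside [Omega] fixes the orientation of the normal. *)
Lemma separates_of_components eps Omega x r u (C1 C2 : set 'rV[R]_N) :
  open Omega -> 0 < eps -> eps < 1 / 2 -> 0 < r -> dotv u u = 1 ->
  (forall y, bdry Omega y -> eball x r y -> `|dotv u (y - x)| <= eps * r) ->
  C1 <> C2 ->
  components (eball x r `&` [set y | 2 * eps * r <= `|dotv u (y - x)|])
    = [set C1; C2] ->
  C1 `<=` Omega -> C2 `<=` ~` Omega ->
  exists v, separates eps Omega x r v.
Proof.
move=> oO e0 e1 r0 u1 slab C12; set S := (X in components X) => hC O1 O2.
have er0 : 0 < eps * r by rewrite mulr_gt0.
pose cap v := eball x r `&` [set y | 2 * eps * r <= dotv v (y - x)].
have cap_conn v : connected (cap v).
  apply: convexs_connected; apply: convexsI;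
    [exact: convexs_eball|exact: convexs_halfspace_le].
have capS : cap u `<=` S /\ cap (- u) `<=` S.
  split=> y [yb /= yd]; split=> //=; apply: le_trans yd _.
    exact: ler_norm.
  by rewrite dotvNl -normrN ler_norm.
have Scap y : S y -> cap u y \/ cap (- u) y.
  move=> [yb /=]; rewrite ler_normr -dotvNl => /orP[yd|yd]; by [left|right].
(* Test points at the least height allowed in the caps; they are in the ball because 2 eps < 1. *)
pose z s := x + (s * (2 * eps * r)) *: u.
have zb s : `|s| = 1 -> eball x r (z s).
  move=> s1; rewrite /eball /= /z addrC addKr enorm_unit_scale // normrM s1.
  by rewrite mul1r gtr0_norm; nra.
have zp : cap u (z 1).
  split; first by apply: zb; rewrite normr1.
  by rewrite /= /z addrC addKr dotvZr u1; lra.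
have zm : cap (- u) (z (-1)).
  split; first by apply: zb; rewrite normrN1.
  by rewrite /= /z addrC addKr !dotvE u1; lra.
have [Sp Sm] := (capS.1 _ zp, capS.2 _ zm).
have pK : cap u `<=` connected_component S (z 1).
  exact: connected_component_max zp capS.1 (cap_conn u).
have mK : cap (- u) `<=` connected_component S (z (-1)).
  exact: connected_component_max zm capS.2 (cap_conn (- u)).
have Kcase y : S y -> connected_component S y = C1 \/ connected_component S y = C2.
  move=> Sy; have : components S (connected_component S y) by exists y.
  by rewrite hC.
(* If both caps met the same component, every point of [S] would belong to it, forcing [C1] =
   [C2]. *)
have Kpm : connected_component S (z 1) <> connected_component S (z (-1)).
  move=> E; apply: C12.
  have compE C : [set C1; C2] C -> C = connected_component S (z 1).
    rewrite -hC => -[y Sy <-]; apply/esym/same_connected_component.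
    by case: (Scap _ Sy) => [/pK//|/mK]; rewrite -E.
  by rewrite (compE C1 (or_introl erefl)) (compE C2 (or_intror erefl)).
have Kp : connected_component S (z 1) (z 1) by exact: connected_component_refl.
have Km : connected_component S (z (-1)) (z (-1)).
  exact: connected_component_refl.
have [pu mu] : eps * r < dotv u (z 1 - x) /\ eps * r < dotv (- u) (z (-1) - x).
  by split; [case: zp => _ /=|case: zm => _ /=]; lra.
have [E1|E1] := Kcase _ Sp; have [E2|E2] := Kcase _ Sm.
- by case: Kpm; rewrite E1 E2.
- exists u; apply: (separates_of_slab _ _ _ _ _ (z 1) (z (-1))) => //.
  + exact: zp.1.
  + by apply: O1; rewrite -E1.
  + exact: zm.1.
  + by apply: O2; rewrite -E2.
- exists (- u); apply: (separates_of_slab _ _ _ _ _ (z (-1)) (z 1)) => //.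
  + by rewrite !dotvE u1; lra.
  + by move=> y yO yb; rewrite dotvNl normrN slab.
  + exact: zm.1.
  + by apply: O1; rewrite -E2.
  + exact: zp.1.
  + by rewrite opprK.
  + by apply: O2; rewrite -E1.
- by case: Kpm; rewrite E1 E2.
Qed.

(** Induction on n covers all scales between (3/4)^n r0 and r0, and these lower bounds tend to 0. *)
Lemma reifenberg_flat_separates eps r0 Omega x r :
  0 < eps -> eps < 1 / 2 -> reifenberg_flat eps r0 Omega -> bdry Omega x ->
  0 < r -> r <= r0 -> exists u, separates eps Omega x r u.
Proof.
move=> e0 e1 [_ oO [P [flatP sepP]]] xO r_gt0 rr0.
have r0_gt0 : 0 < r0 by exact: lt_le_trans rr0.
(* The equation of [P x s] is kept because the separation condition at scale [r0] refers to this
   same hyperplane. *)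
have slab s : 0 < s -> s <= r0 -> exists u, [/\ dotv u u = 1,
    P x s = [set y | dotv u (y - x) = 0] &
    forall y, bdry Omega y -> eball x s y -> `|dotv u (y - x)| <= eps * s].
  move=> s0 sr0; have [hP Px hd] := flatP _ _ xO s0 sr0.
  have [u u1 PE] := hyperplane_unit_normal _ _ hP Px.
  exists u; split=> //; apply: flat_bdry_slab => //.
  by rewrite -PE.
have base : exists u, separates eps Omega x r0 u.
  have [u [u1 PE us]] := slab _ r0_gt0 (lexx _).
  have [C1 [C2 [C12 hC O1 O2]]] := sepP _ xO.
  apply: (separates_of_components _ _ _ _ u C1 C2) => //; rewrite -hC PE.
  by congr (components (_ `&` _)); apply/seteqP; split=> y /=;
    rewrite dist_set_hyperplane_ge.
have scales n : forall s, 0 < s -> (3 / 4) ^+ n * r0 <= s -> s <= r0 ->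
    exists u, separates eps Omega x s u.
  elim: n => [|n IH] s s0 ns sr0.
    suff -> : s = r0 by [].
    by apply/le_anti; rewrite sr0; move: ns; rewrite expr0 mul1r.
  (* The intermediate scale is t = min(4s/3, r0), covered by the induction hypothesis. *)
  have [t [t0 tn tr0 st ts]] : exists t, [/\ 0 < t, (3 / 4) ^+ n * r0 <= t,
      t <= r0, s <= t & 3 * t <= 4 * s].
    move: ns; rewrite exprS; set q := _ ^+ n => ns.
    have q1 : q <= 1 by apply: exprn_ile1; lra.
    by have [h|h] := lerP (4 / 3 * s) r0; [exists (4 / 3 * s)|exists r0];
      split=> //; nra.
  have [u us] := IH _ t0 tn tr0.
  have [v [v1 _ vs]] := slab _ s0 sr0.
  exact: (separates_smaller _ _ _ _ _ u v) us v1 vs.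
have [n nr] : exists n, (3 / 4) ^+ n * r0 <= r.
  have : (fun n => r0 * (3 / 4) ^+ n) @ \oo --> (0 : R).
    by apply: cvg_geometric; rewrite ger0_norm; lra.
  move=> /cvgrPdist_lt/(_ r r_gt0)[n _ /(_ n (leqnn n))] /=.
  rewrite sub0r normrN => /ltW/ler_normlW h.
  by exists n; rewrite mulrC.
exact: scales nr rr0.
Qed.

(** * From separated sides to lower bounds on Hausdorff distances *)

(** The balls are centred at x + k u and x - k u, where k and [rho] are the midpoint and half-length
    of [2 eps r, r]: k + rho = r keeps them in the large ball, and k - rho = 2 eps r > eps r keeps
    them beyond the slab. *)
Lemma separates_balls eps Omega x r u :
  0 < eps -> eps < 1 / 2 -> 0 < r -> separates eps Omega x r u ->
  let rho := r * (1 - 2 * eps) / 2 in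
  exists zp zm, [/\ eball zp rho `<=` Omega, eball zm rho `<=` ~` Omega,
    eball zp rho `<=` eball x r & eball zm rho `<=` eball x r].
Proof.
move=> e0 e1 r0 [u1 sp sm] rho.
pose k := r * (1 + 2 * eps) / 2.
have k0 : 0 <= k by rewrite /k; nra.
have krho : k + rho = r by rewrite /k /rho; field.
have near v z y : dotv v v = 1 -> z = x + k *: v -> eball z rho y ->
    eball x r y /\ eps * r < dotv v (y - x).
  move=> v1 zE yz; split.
    rewrite /eball /=; apply: le_lt_trans (ler_enorm_sub y z x) _.
    rewrite -krho addrC ler_ltD // zE addrC addKr.
    by rewrite enorm_unit_scale // ger0_norm.
  have : dotv v (y - x) = k + dotv v (y - z).
    by rewrite zE !dotvE v1; ring.
  have := le_lt_trans (normr_dotv_unit _ (y - z) v1) yz.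
  rewrite ltr_norml => /andP[h _] ->.
  have er0 : 0 < eps * r by rewrite mulr_gt0.
  have : 2 * eps * r = k - rho by rewrite /k /rho; field.
  lra.
have v1 : dotv (- u) (- u) = 1 by rewrite !dotvE u1; ring.
exists (x + k *: u), (x + k *: (- u)); split=> y yz.
- by have [? ?] := near _ _ _ u1 erefl yz; exact: sp.
- by have [? ?] := near _ _ _ v1 erefl yz; exact: sm.
- by have [] := near _ _ _ u1 erefl yz.
- by have [] := near _ _ _ v1 erefl yz.
Qed.

Lemma hausdorff_dist_ge_of_ball eps r0 (X Y : set 'rV[R]_N) x delta :
  0 < eps -> eps < 1 / 2 -> reifenberg_flat eps r0 X -> open Y -> bdry X x ->
  0 < delta -> delta <= 2 * r0 -> (forall y, eball x delta y -> ~ bdry Y y) ->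
  ((delta * (1 - 2 * eps) / 4)%:E
   <= mine (hausdorff_dist X Y) (hausdorff_dist (~` X) (~` Y)))%E.
Proof.
move=> e0 e1 flatX oY xX d0 dr0 dY; set rho := _ / 4.
(* Separation is available only up to [r0], while [delta] may reach 2 [r0]; halving the radius is
   what produces the factor 4. *)
have r_gt0 : 0 < delta / 2 by lra.
have r_le : delta / 2 <= r0 by lra.
have [u us] := reifenberg_flat_separates _ _ _ _ _ e0 e1 flatX xX r_gt0 r_le.
have [zp [zm]] := separates_balls _ _ _ _ _ e0 e1 r_gt0 us.
have -> : delta / 2 * (1 - 2 * eps) / 2 = rho by rewrite /rho; field.
move=> [pX mX pb mb].
have half : eball x (delta / 2) `<=` eball x delta.
  by move=> y; rewrite /eball /= => ?; lra.
have {}pb := subset_trans pb half; have {}mb := subset_trans mb half.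
have rho0 : 0 < rho by rewrite /rho; nra.
have ctr (c : 'rV[R]_N) s : 0 < s -> eball c s c.
  by rewrite /eball /= subrr enorm0.
have same y z : eball x delta y -> eball x delta z -> Y y -> Y z.
  move=> yb zb Yy; apply: (connected_disjoint_bdry _ _ _ oY _ dY y) => //.
  exact: convexs_connected (convexs_eball _ _).
rewrite le_min.
(* If [Y] contains the ball, [zm] lies in [Y] and outside [X], and its small ball misses both [X]
   and the complement of [Y]; otherwise [zp] plays this role with [X] and [Y] exchanged. *)
have [Yx|Yx] := pselect (Y x).
  have YB y : eball x delta y -> Y y by move=> yb; exact: same (ctr _ _ d0) yb Yx.
  rewrite hausdorff_distC; apply/andP; split; apply: (hausdorff_dist_ge _ zm).
  - exact: YB (mb _ (ctr _ _ rho0)).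
  - exact: mX.
  - exact: mX (ctr _ _ rho0).
  - by move=> y /mb/YB Yy; apply.
have YB y : eball x delta y -> ~ Y y.
  by move=> yb Yy; apply: Yx; exact: same yb (ctr _ _ d0) Yy.
rewrite (hausdorff_distC (~` X)).
apply/andP; split; apply: (hausdorff_dist_ge _ zp).
- exact: pX (ctr _ _ rho0).
- by move=> y /pb/YB.
- exact: YB (pb _ (ctr _ _ rho0)).
- by move=> y /pX Xy; apply.
Qed.

Lemma excess_bdry_le eps r0 (X Y : set 'rV[R]_N) :
  0 < eps -> eps < 1 / 2 -> reifenberg_flat eps r0 X -> open Y ->
  (excess (bdry X) (bdry Y) <= (2 * r0)%:E)%E ->
  (excess (bdry X) (bdry Y) <= (4 / (1 - 2 * eps))%:E *
     mine (hausdorff_dist X Y) (hausdorff_dist (~` X) (~` Y)))%E.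
Proof.
move=> e0 e1 flatX oY XY; set m := mine _ _.
have m0 : (0 <= m)%E by rewrite le_min !hausdorff_dist_ge0.
have K0 : 0 < 4 / (1 - 2 * eps) by rewrite divr_gt0 //; lra.
rewrite /excess ge_max mule_ge0 ?lee_fin ?(ltW K0) //=.
apply: ge_ereal_sup => _ [x xX <-]; rewrite leNgt; apply/negP => mD.
have Dr0 := le_trans (dist_set_le_excess x (bdry X) (bdry Y) xX) XY.
have lb (delta : R) : 0 < delta -> (delta%:E < dist_set x (bdry Y))%E ->
    ((delta * (1 - 2 * eps) / 4)%:E <= m)%E.
  move=> d0 dD; apply: hausdorff_dist_ge_of_ball flatX oY xX d0 _ _ => //.
    by rewrite -lee_fin; apply: ltW; exact: lt_le_trans dD Dr0.
  move=> y yb yY; have := lt_le_trans dD (dist_set_le x _ y yY).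
  by rewrite lte_fin enormB ltNge (ltW yb).
(* An infinite [m] contradicts [mD]; below, [Dr0] excludes an infinite distance, which also covers
   an empty boundary of [Y]. *)
clearbody m; case: m m0 mD lb => [m| |] //=; last first.
  by move=> _; rewrite gt0_muley ?lte_fin // ltNge leey.
rewrite lee_fin -EFinM; case: (dist_set x _) Dr0 => [D| |] //.
rewrite lee_fin lte_fin => Dr0 m0 mD lb.
have Km0 : 0 <= 4 / (1 - 2 * eps) * m by rewrite mulr_ge0 // ltW.
(* The radius is the midpoint between the claimed bound, named [K] below, and the larger distance
   [D]; the lower bound on [m] then says that this midpoint is at most [K], a contradiction. *)
have := lb ((4 / (1 - 2 * eps) * m + D) / 2); rewrite lte_fin lee_fin.
have -> : m = (4 / (1 - 2 * eps) * m) * (1 - 2 * eps) / 4 by field; lra.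
set K := 4 / _ * m in mD Km0 *.
have -> : 4 / (1 - 2 * eps) * (K * (1 - 2 * eps) / 4) = K by field; lra.
move=> h; have : (K + D) / 2 * (1 - 2 * eps) / 4 <= K * (1 - 2 * eps) / 4.
  by apply: h; lra.
nra.
Qed.

End Separation.

Theorem lemma15 (R : realType) (N : nat) (eps r0 : R)
    (heps0 : 0 < eps) (heps1 : eps < 1 / 2) (hr0 : 0 < r0)
    (X Y : set 'rV[R]_N)
    (hX : reifenberg_flat eps r0 X) (hY : reifenberg_flat eps r0 Y)
    (hXY : (hausdorff_dist (bdry X) (bdry Y) <= (2 * r0)%:E)%E) :
  (hausdorff_dist (bdry X) (bdry Y)
   <= (4 / (1 - 2 * eps))%:E *
      mine (hausdorff_dist X Y) (hausdorff_dist (~` X) (~` Y)))%E.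
Proof.
have [[_ oX _] [_ oY _]] := (hX, hY).
move: hXY; rewrite !hausdorff_dist_le => /andP[XY YX].
apply/andP; split; first exact: excess_bdry_le XY.
(* The right-hand side is symmetric, so the other excess follows with [X] and [Y] exchanged. *)
rewrite hausdorff_distC (hausdorff_distC (~` X)).
exact: excess_bdry_le YX.
Qed.
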